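(* $\Pi A_n$ is not residually nilpotent for $n\ge 3$.
   Context: $F_n$ is the free group with free basis $x_1,\dots,x_n$. A palindrome is a reduced word in $x_1^{\pm1},\dots,x_n^{\pm1}$ that equals its reverse word (same letters, with their exponents, read in the opposite order). $\Pi A_n\le \mathrm{Aut}(F_n)$ is the palindromic automorphism group, consisting of all automorphisms of $F_n$ that map each $x_i$ to a palindrome. A group $G$ is residually nilpotent if $\bigcap_{k\ge1}\gamma_k(G)=1$, where $\gamma_k(G)$ is the $k$th term of the lower central series. *)

(* Defs.v *)
From HB Require Import structures.
From mathcomp Require Import all_boot.
From mathcomp Require Import boolp classical_sets.

Set Implicit Arguments.
Unset Strict Implicit.
Unset Printing Implicit Defensive.

Import Algebra.
Local Open Scope group_scope.

Definition is_subgroup (G : groupType) (H : set G) : Prop :=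
  H 1 /\ forall x y, H x -> H y -> H (x / y).

Definition generated (G : groupType) (S : set G) : set G :=
  smallest (@is_subgroup G) S.

(* The numbering is that of 'L_k(G) in solvable.nilpotent: the terms for
   k = 0 and k = 1 are both the whole group. *)
Definition lower_central (G : groupType) (k : nat) : set G :=
  iter k.-1
    (fun H => generated [set z | exists x y : G, H x /\ z = [~ x, y]]%classic)
    [set: G]%classic.

Definition residually_nilpotent (G : groupType) : Prop :=
  (\bigcap_(k in [set k | (1 <= k)%N]) @lower_central G k = [set 1])%classic.

Record aut (G : groupType) := Aut {
  aut_fun :> G -> G;
  autM : {morph aut_fun : x y / x * y};
  aut_bij : bijective aut_fun
}.

HB.instance Definition _ (G : groupType) := gen_eqMixin (aut G).
HB.instance Definition _ (G : groupType) := gen_choiceMixin (aut G).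

Section AutGroup.
Variable G : groupType.
Implicit Types f g h : aut G.

Lemma autP f g : f =1 g -> f = g.
Proof.
case: f g => [f fM fB] [g gM gB] /= /funext efg.
by case: _ / efg in gM gB *; congr Aut; apply: Prop_irrelevance.
Qed.

Definition aut1 : aut G :=
  @Aut G idfun (fun _ _ => erefl) (Bijective (fun=> erefl) (fun=> erefl)).

Fact aut_mulM f g : {morph f \o g : x y / x * y}.
Proof. by move=> x y /=; rewrite !autM. Qed.

Definition aut_mul f g : aut G :=
  Aut (@aut_mulM f g) (bij_comp (aut_bij f) (aut_bij g)).

Fact aut_invP f : {g : aut G | cancel f g & cancel g f}.
Proof.
have /cid[g [fK gK]] : exists g : G -> G, cancel f g /\ cancel g f.
  by case: (aut_bij f) => g fK gK; exists g.
have gM : {morph g : x y / x * y}.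
  by move=> x y; apply: (canLR fK); rewrite autM !gK.
by exists (Aut gM (Bijective gK fK)).
Qed.

Definition aut_inv f : aut G := s2val (aut_invP f).

Lemma aut_invK f : cancel f (aut_inv f).
Proof. exact: s2valP (aut_invP f). Qed.

Lemma aut_invVK f : cancel (aut_inv f) f.
Proof. exact: s2valP' (aut_invP f). Qed.

Fact aut_mulA : associative aut_mul.
Proof. by move=> f g h; apply: autP. Qed.
Fact aut_mul1g : left_id aut1 aut_mul.
Proof. by move=> f; apply: autP. Qed.
Fact aut_mulg1 : right_id aut1 aut_mul.
Proof. by move=> f; apply: autP. Qed.
Fact aut_mulVg : left_inverse aut1 aut_inv aut_mul.
Proof. by move=> f; apply: autP => x /=; rewrite aut_invK. Qed.
Fact aut_mulgV : right_inverse aut1 aut_inv aut_mul.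
Proof. by move=> f; apply: autP => x /=; rewrite aut_invVK. Qed.

HB.instance Definition _ := isGroup.Build (aut G)
  aut_mulA aut_mul1g aut_mulg1 aut_mulVg aut_mulgV.

Lemma aut1E x : (1 : aut G) x = x. Proof. by []. Qed.
Lemma autME f g x : (f * g) x = f (g x). Proof. by []. Qed.
Lemma autKV f : cancel f (f^-1). Proof. exact: aut_invK. Qed.
Lemma autVK f : cancel (f^-1) f. Proof. exact: aut_invVK. Qed.

Lemma aut_1 f : f 1 = 1.
Proof. by apply: (@mulIg _ (f 1)); rewrite -autM !mul1g. Qed.

Lemma aut_V f x : f x^-1 = (f x)^-1.
Proof. by apply: (@mulIg _ (f x)); rewrite -autM !mulVg aut_1. Qed.

End AutGroup.

Section FreeGroup.
Variable n : nat.

(* [(i, true)] stands for [x_i] and [(i, false)] for its inverse. *)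
Definition letter : Type := 'I_n * bool.
HB.instance Definition _ := Finite.on letter.

Implicit Types (a b : letter) (s t w : seq letter).

Definition linv a : letter := (a.1, ~~ a.2).

Definition reduced w := sorted (fun a b => b != linv a) w.

(* The reduced form of [a :: w], for a reduced word [w]. *)
Definition push a w :=
  if w is b :: w' then if b == linv a then w' else a :: w else [:: a].

Definition reduce w := foldr push [::] w.

Lemma linvK : involutive linv.
Proof. by case=> i b; rewrite /linv /= negbK. Qed.

Lemma linv_sym a b : (b == linv a) = (a == linv b).
Proof. by apply/eqP/eqP=> ->; rewrite linvK. Qed.

Lemma reduced_behead a w : reduced (a :: w) -> reduced w.
Proof. exact: path_sorted. Qed.

Lemma push_reduced a w : reduced w -> reduced (push a w).
Proof.
case: w => //= b w rbw; case: ifPn => [_|ab]; first exact: reduced_behead rbw.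
by rewrite /reduced /= ab.
Qed.

Lemma push_id a w : reduced (a :: w) -> push a w = a :: w.
Proof. by case: w => //= b w /andP[/negPf-> _]. Qed.

Lemma pushK a w : reduced w -> push (linv a) (push a w) = w.
Proof.
case: w => [|b w] rw /=; first by rewrite linvK eqxx.
have [eb|_] := eqVneq b (linv a); last by rewrite /= linvK eqxx.
by rewrite -eb push_id.
Qed.

Lemma pushVK a w : reduced w -> push a (push (linv a) w) = w.
Proof. by move=> rw; rewrite -{1}[a]linvK pushK. Qed.

Lemma foldr_push_reduced s w : reduced w -> reduced (foldr push w s).
Proof. by move=> rw; elim: s => //= a s; apply: push_reduced. Qed.

Lemma foldr_push_push a s w : reduced w ->
  foldr push w (push a s) = push a (foldr push w s).
Proof.
case: s => [//|b s] rw /=; case: eqP => [->|//].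
by rewrite pushVK ?foldr_push_reduced.
Qed.

Lemma reduce_id w : reduced w -> reduce w = w.
Proof.
elim: w => //= a w IHw raw; rewrite (IHw (reduced_behead raw)).
exact: push_id.
Qed.

Definition winv w := rev (map linv w).

Lemma reduced_rev w : reduced w -> reduced (rev w).
Proof.
by rewrite /reduced rev_sorted; apply: sub_sorted => a b; rewrite linv_sym.
Qed.

Lemma reduced_winv w : reduced w -> reduced (winv w).
Proof.
move=> rw; apply: reduced_rev; rewrite /reduced sorted_map.
by apply: sub_sorted rw => a b /=; rewrite (inj_eq (inv_inj linvK)).
Qed.

Lemma winvK : involutive winv.
Proof. by move=> w; rewrite /winv map_rev revK mapK //; apply: linvK. Qed.

Lemma winv_mul w : reduced w -> foldr push w (winv w) = [::].
Proof.
elim: w => //= a w IHw raw.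
rewrite /winv /= rev_cons -cats1 foldr_cat /= linvK eqxx.
exact: IHw (reduced_behead raw).
Qed.

(* The free group on [x_0], ..., [x_{n-1}], realized on the reduced words. *)
Record free_group := FreeGroup {
  word :> seq letter;
  word_reduced : reduced word
}.

HB.instance Definition _ := [isSub for word].
HB.instance Definition _ := [Choice of free_group by <:].

Implicit Types u v : free_group.

Definition free_one : free_group := @FreeGroup [::] isT.
Definition free_mul u v : free_group :=
  FreeGroup (foldr_push_reduced u (word_reduced v)).
Definition free_inv u : free_group :=
  FreeGroup (reduced_winv (word_reduced u)).

Fact free_mulA : associative free_mul.
Proof.
move=> u v w; apply: val_inj => /=; elim: (word u) => //= a s ->.
by rewrite foldr_push_push ?word_reduced.
Qed.
Fact free_mul1g : left_id free_one free_mul.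
Proof. by move=> u; apply: val_inj. Qed.
Fact free_mulg1 : right_id free_one free_mul.
Proof. by move=> u; apply: val_inj; apply/reduce_id/word_reduced. Qed.
Fact free_mulVg : left_inverse free_one free_inv free_mul.
Proof. by move=> u; apply/val_inj/winv_mul/word_reduced. Qed.
Fact free_mulgV : right_inverse free_one free_inv free_mul.
Proof.
move=> u; rewrite -{1}[u](_ : free_inv (free_inv u) = u) ?free_mulVg //.
by apply: val_inj; apply: winvK.
Qed.

HB.instance Definition _ := isGroup.Build free_group
  free_mulA free_mul1g free_mulg1 free_mulVg free_mulgV.

Definition free_letter a : free_group := @FreeGroup [:: a] isT.

Definition free_gen (i : 'I_n) : free_group := free_letter (i, true).

Lemma word1 : word 1 = [::]. Proof. by []. Qed.
Lemma wordM u v : word (u * v) = reduce (word u ++ word v).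
Proof. by rewrite /reduce foldr_cat -/(reduce v) reduce_id ?word_reduced. Qed.

Lemma free_letterV a : free_letter (linv a) = (free_letter a)^-1.
Proof. exact: val_inj. Qed.

Definition free_eval w : free_group := \prod_(a <- w) free_letter a.

Lemma word_eval w : word (free_eval w) = reduce w.
Proof. by elim: w => [|a w IHw]; rewrite /free_eval ?big_nil ?big_cons //= IHw. Qed.

Lemma free_eval_word u : free_eval u = u.
Proof. by apply: val_inj; rewrite [LHS]word_eval reduce_id ?word_reduced. Qed.

Definition palindrome u : bool := rev (word u) == word u.

(* The reversal anti-automorphism, whose fixed points are the palindromes. *)
Definition free_rev u : free_group := free_eval (rev (word u)).

Lemma word_rev u : word (free_rev u) = rev (word u).
Proof. by rewrite word_eval reduce_id // reduced_rev ?word_reduced. Qed.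

Lemma palindromeE u : palindrome u = (free_rev u == u).
Proof. by rewrite -val_eqE /= word_rev. Qed.

Lemma free_eval_rev_reduce w : free_eval (rev (reduce w)) = free_eval (rev w).
Proof.
rewrite /free_eval; elim: w => //= a w IHw.
rewrite rev_cons -cats1 big_cat /= -IHw -big_cat cats1 -rev_cons.
case: (reduce w) => [//|b s] /=; case: eqP => [->|//].
rewrite !rev_cons -!cats1 !big_cat /= !big_seq1.
by rewrite free_letterV -mulgA mulVg mulg1.
Qed.

Lemma free_revM u v : free_rev (u * v) = free_rev v * free_rev u.
Proof.
by rewrite /free_rev wordM free_eval_rev_reduce rev_cat /free_eval big_cat.
Qed.

Lemma free_rev1 : free_rev 1 = 1.
Proof. by rewrite /free_rev word1 /free_eval big_nil. Qed.

Lemma free_revV u : free_rev u^-1 = (free_rev u)^-1.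
Proof. by apply: (@mulgI _ (free_rev u)); rewrite -free_revM mulVg mulgV free_rev1. Qed.

Lemma free_rev_letter a : free_rev (free_letter a) = free_letter a.
Proof. by rewrite /free_rev /free_eval big_seq1. Qed.

Definition palindromic : pred (aut free_group) :=
  fun f => [forall i, palindrome (f (free_gen i))].

Lemma palindromicP (f : aut free_group) :
  reflect (forall u, f (free_rev u) = free_rev (f u)) (palindromic f).
Proof.
apply: (iffP forallP) => [pf u|fR i]; last first.
  by rewrite palindromeE -fR free_rev_letter.
have pfl a : free_rev (f (free_letter a)) = f (free_letter a).
  have pg i : free_rev (f (free_gen i)) = f (free_gen i).
    by apply/eqP; rewrite -palindromeE.
  case: a => i [|]; first exact: pg.
  by rewrite (free_letterV (i, true)) aut_V free_revV pg.
rewrite -[u]free_eval_word; elim: (word u) => [|a w IHw].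
  by rewrite /free_eval big_nil free_rev1 aut_1 free_rev1.
rewrite /free_eval big_cons -/(free_eval w).
by rewrite free_revM !autM free_revM pfl IHw free_rev_letter.
Qed.

Fact palindromic_group_closed : group_closed palindromic.
Proof.
split; first by apply/palindromicP.
move=> f g /palindromicP fR /palindromicP gR; apply/palindromicP => u.
have gVR v : g^-1 (free_rev v) = free_rev (g^-1 v).
  by apply: (canLR (autKV g)); rewrite gR autVK.
by rewrite !autME gVR fR.
Qed.

(* The subgroup of [aut free_group] of those automorphisms that map each
   [x_i] to a palindrome; it is given a type of its own so as to be a
   [groupType]. *)
Record PiA := MkPiA {
  PiA_aut :> aut free_group;
  PiA_palindromic : palindromic PiA_aut
}.

HB.instance Definition _ := [isSub for PiA_aut].
HB.instance Definition _ := [Choice of PiA by <:].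
HB.instance Definition _ :=
  SubChoice_isSubGroup.Build _ _ PiA palindromic_group_closed.

End FreeGroup.

(* Main.v *)
Require Import Defs.
From HB Require Import structures.
From mathcomp Require Import all_boot.
From mathcomp Require Import boolp classical_sets.
From mathcomp Require Import fingroup perm.

Set Implicit Arguments.
Unset Strict Implicit.
Unset Printing Implicit Defensive.

Local Open Scope group_scope.

(** The symmetric group embeds in the palindromic automorphism group, since
   permuting the basis sends each [x_i] to a one-letter word.  For three or
   more generators it thus contains a copy of [S_3], a finite group that is
   not nilpotent.  Concretely, two transpositions sharing a point are
   involutions [f] and [g] with [f * g * f = g * f * g], and these relations
   force [[~ f * g, f] = f * g]: the 3-cycle [f * g] is its own commutator with [f],
   so it survives in every term of the lower central series
   ([lower_central_self_commutator]).  In a residually nilpotent group such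
   [f] and [g] would therefore coincide ([residually_nilpotent_braid]), whereas
   the two transpositions act differently on the basis. *)

Section SelfCommutators.
Variable G : groupType.
Implicit Types x y f g : G.

Lemma lower_central_self_commutator x y k :
  [~ x, y] = x -> lower_central k x.
Proof.
move=> xyx; rewrite /lower_central; elim: k.-1 => //= m xm H [_ subH].
by apply: subH; exists x, y.
Qed.

(** The relations present [S_3], whose 3-cycles lie in every term of its lower
   central series; residual nilpotence kills them, leaving a quotient of
   order at most 2. *)
Lemma residually_nilpotent_braid f g :
    f * f = 1 -> g * g = 1 -> f * g * f = g * f * g ->
  residually_nilpotent G -> f = g.
Proof.
move=> ff gg fgf rnG.
have fV : f^-1 = f by apply: (@mulgI _ f); rewrite mulgV ff.
have gV : g^-1 = g by apply: (@mulgI _ g); rewrite mulgV gg.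
have cfg : [~ f * g, f] = f * g.
  rewrite commgEl conjgE invgM fV gV !mulgA.
  by rewrite -(mulgA g f f) ff mulg1 -fgf -mulgA ff mulg1.
have : (\bigcap_(k in [set k | (1 <= k)%N]) @lower_central G k)%classic (f * g).
  by move=> k _; apply: lower_central_self_commutator cfg.
rewrite rnG => /= fg1.
by apply: (@mulIg _ g); rewrite fg1 gg.
Qed.

End SelfCommutators.

Section PermutationAutomorphisms.
Variable n : nat.
Implicit Types (s t : {perm 'I_n}) (a : letter n) (w : seq (letter n)).

Definition perm_letter s a : letter n := (s a.1, a.2).

Lemma perm_letter_inj s : injective (perm_letter s).
Proof. by move=> [i b] [j c] [] /perm_inj-> ->. Qed.

Lemma perm_letter_linv s a : perm_letter s (linv a) = linv (perm_letter s a).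
Proof. by []. Qed.

Lemma perm_word_reduced s w : reduced w -> reduced (map (perm_letter s) w).
Proof.
rewrite /reduced sorted_map; apply: sub_sorted => a b /=.
by rewrite -perm_letter_linv (inj_eq (@perm_letter_inj s)).
Qed.

Lemma map_perm_push s a w :
  map (perm_letter s) (push a w) = push (perm_letter s a) (map (perm_letter s) w).
Proof.
case: w => //= b w; rewrite -perm_letter_linv (inj_eq (@perm_letter_inj s)).
by case: ifP.
Qed.

Definition perm_free s (u : free_group n) : free_group n :=
  FreeGroup (perm_word_reduced s (word_reduced u)).

Lemma perm_freeM s : {morph perm_free s : u v / u * v}.
Proof.
move=> u v; apply: val_inj => /=; elim: (word u) => //= a w <-.
exact: map_perm_push.
Qed.

Lemma perm_free_comp s t u : perm_free (s * t) u = perm_free t (perm_free s u).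
Proof.
apply: val_inj => /=; rewrite -map_comp; apply: eq_map => -[i b] /=.
by rewrite /perm_letter /= permM.
Qed.

Lemma perm_free1 u : perm_free 1 u = u.
Proof.
by apply: val_inj => /=; apply: map_id_in => -[i b] _; rewrite /perm_letter perm1.
Qed.

Lemma perm_free_bij s : bijective (perm_free s).
Proof.
exists (perm_free s^-1) => u.
  by rewrite -perm_free_comp mulgV perm_free1.
by rewrite -perm_free_comp mulVg perm_free1.
Qed.

Lemma perm_free_palindromic s : palindromic (Aut (@perm_freeM s) (perm_free_bij s)).
Proof. by apply/forallP => i; apply/eqP. Qed.

Definition perm_PiA s : PiA n := MkPiA (perm_free_palindromic s).

(** Permutations compose from left to right and automorphisms from right to
   left, hence the reversal of the factors. *)
Lemma perm_PiAM s t : perm_PiA (s * t) = perm_PiA t * perm_PiA s.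
Proof. by apply: val_inj; apply: autP => u; apply: perm_free_comp. Qed.

Lemma perm_PiA1 : perm_PiA 1 = 1.
Proof. by apply: val_inj; apply: autP => u; apply: perm_free1. Qed.

Lemma perm_PiA_inj : injective perm_PiA.
Proof.
move=> s t est; apply/permP => i.
have /= := congr1 (fun f : PiA n => word (f (free_gen i))) est.
by case.
Qed.

End PermutationAutomorphisms.

Lemma tperm_braid (T : finType) (x y z : T) : x != z -> y != z -> x != y ->
  tperm x y * tperm y z * tperm x y = tperm y z * tperm x y * tperm y z.
Proof.
move=> xz yz xy.
have := tpermJ y z (tperm x y); have := tpermJ x y (tperm y z).
rewrite !conjgE !tpermV !mulgA tpermR tpermL => -> ->.
by rewrite (tpermD xz yz) tpermD // eq_sym.
Qed.

Theorem proposition5p1 (n : nat) (hn : (3 <= n)%N) :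
  ~ residually_nilpotent (PiA n).
Proof.
case: n hn => [|[|[|n]]] // _ rnG.
pose x : 'I_n.+3 := inord 0; pose y : 'I_n.+3 := inord 1.
pose z : 'I_n.+3 := inord 2.
have xy : x != y by rewrite -val_eqE /= !inordK.
have xz : x != z by rewrite -val_eqE /= !inordK.
have yz : y != z by rewrite -val_eqE /= !inordK.
have /perm_PiA_inj : perm_PiA (tperm x y) = perm_PiA (tperm y z).
  apply: residually_nilpotent_braid rnG; rewrite -!perm_PiAM.
  - by rewrite tperm2 perm_PiA1.
  - by rewrite tperm2 perm_PiA1.
  - by rewrite !mulgA tperm_braid.
move=> /permP/(_ x); rewrite tpermL tpermD 1?eq_sym // => yx.
by rewrite yx eqxx in xy.
Qed.
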